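(* For every dimension $d\geq 1$ and every $\alpha\in(0,1)$ the following holds. Let $\mathcal{C}$ be a finite family of convex bodies in $\mathbb{R}^d$. Assume that among all subfamilies of $\mathcal{C}$ of size $\frac{d(d+3)}{2}$, there are at least $\alpha\binom{|\mathcal{C}|}{d(d+3)/2}$ for which the intersection of the $\frac{d(d+3)}{2}$ members contains an ellipsoid of volume one. Then there is a subfamily $\mathcal{C}'\subset\mathcal{C}$ of size at least $\beta|\mathcal{C}|$ such that the intersection of all members of $\mathcal{C}'$ contains an ellipsoid of volume one, where $\beta=\frac{2\alpha}{d(d+3)}$.
   Context: A convex body is a compact convex set with nonempty interior. An ellipsoid in $\mathbb{R}^d$ is the image of the closed Euclidean unit ball under an invertible affine map; volume is $d$-dimensional Lebesgue measure.
   Formalization: The formal statement additionally assumes |C| ≥ d(d+3)/2; otherwise the binomial is 0, the assumption is vacuous and the claim fails, e.g. d = 1, C = {[0,1/2]}. *)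

(* Defs.v *)
From HB Require Import structures.
From mathcomp Require Import all_boot all_order all_algebra.
From mathcomp Require Import all_classical all_reals all_analysis.

Set Implicit Arguments.
Unset Strict Implicit.
Unset Printing Implicit Defensive.

Import Order.TTheory GRing.Theory Num.Theory.
Import numFieldNormedType.Exports.

Local Open Scope classical_set_scope.
Local Open Scope ring_scope.

Section TupleMeasure.
Variable R : realType.
Local Notation mR := (measurableTypeR R).

Definition cons_pair n (x : mR * n.-tuple mR) : n.+1.-tuple mR :=
  [tuple of x.1 :: x.2].

Lemma measurable_cons_pair n : measurable_fun setT (@cons_pair n).
Proof. exact: measurable_cons. Qed.

Lemma measurable_cons_pair_image n (A : set (mR * n.-tuple mR)) :
  measurable A -> measurable (@cons_pair n @` A).
Proof.
move=> mA.
pose uncons (t : n.+1.-tuple mR) : mR * n.-tuple mR :=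
  (thead t, [tuple of behead t]).
have cons_pairK : cancel (@cons_pair n) uncons.
  by move=> [x s]; congr pair; exact: val_inj.
have muncons : measurable_fun setT uncons.
  by apply: measurable_fun_pair; [exact: measurable_tnth|exact: measurable_behead].
rewrite (_ : _ @` _ = uncons @^-1` A); first
  by rewrite -[X in measurable X]setTI; exact: muncons.
apply/seteqP; split => [_ [[x s] Axs <-]|t At]; last first.
  by exists (uncons t) => //; rewrite /cons_pair /= -tuple_eta.
by rewrite /= cons_pairK.
Qed.

Lemma cons_pair_inj n : injective (@cons_pair n).
Proof. by move=> [x s] [y t] /(congr1 val) /= [-> /val_inj ->]. Qed.

Section TupleCons.
Variables (n : nat) (m : {sigma_finite_measure set (n.-tuple mR) -> \bar R}).

Definition tuple_measureS : set (n.+1.-tuple mR) -> \bar R :=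
  pushforward (lebesgue_measure \x m)%E (@cons_pair n).

Let tuple_measureS0 : tuple_measureS set0 = 0%E.
Proof. by rewrite /tuple_measureS /pushforward preimage_set0 measure0. Qed.

Let tuple_measureS_ge0 A : (0 <= tuple_measureS A)%E.
Proof. exact: (measure_ge0 (lebesgue_measure \x m)%E). Qed.

Let tuple_measureS_sigma_additive : semi_sigma_additive tuple_measureS.
Proof.
move=> F mF tF mUF; rewrite /tuple_measureS /pushforward preimage_bigcup.
apply: measure_semi_sigma_additive.
- by move=> k; rewrite -[X in measurable X]setTI; exact: measurable_cons_pair.
- apply/trivIsetP => /= i j _ _ ij; rewrite -preimage_setI.
  by move/trivIsetP : tF => /(_ _ _ _ _ ij) ->//; rewrite preimage_set0.
- rewrite -preimage_bigcup -[X in measurable X]setTI.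
  exact: measurable_cons_pair.
Qed.

HB.instance Definition _ := isMeasure.Build _ _ _ tuple_measureS
  tuple_measureS0 tuple_measureS_ge0 tuple_measureS_sigma_additive.

Let tuple_measureS_sigma_finite : sigma_finite setT tuple_measureS.
Proof.
have [F TF Foo] : sigma_finite setT (lebesgue_measure \x m)%E.
  have /sigma_finiteP[F [TF ndF Foo]] : sigma_finite setT (@lebesgue_measure R).
    exact: sigma_finiteT.
  have /sigma_finiteP[G [TG ndG Goo]] := sigma_finiteT m.
  exists (fun k => F k `*` G k).
    rewrite -setXTT TF TG; apply/seteqP; split=> -[x y] /=.
      move=> [[i _ Fx] [j _ Gy]]; exists (maxn i j) => //; split.
      - by move: x Fx; exact/subsetPset/ndF/leq_maxl.
      - by move: y Gy; exact/subsetPset/ndG/leq_maxr.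
    by move=> [k _ [/= ? ?]]; split; exists k.
  move=> k; have [? ?] := Foo k; have [? ?] := Goo k.
  split; first exact: measurableX.
  by rewrite product_measure1E// lte_mul_pinfty// ge0_fin_numE.
exists (fun k => @cons_pair n @` F k).
  apply/seteqP; split => // t _.
  have : [set: mR * n.-tuple mR] (thead t, [tuple of behead t]) by [].
  rewrite TF => -[k _ Fk]; exists k => //.
  by exists (thead t, [tuple of behead t]) => //; rewrite /cons_pair /= -tuple_eta.
move=> k; have [mF oo] := Foo k; split; first exact: measurable_cons_pair_image.
rewrite /tuple_measureS /pushforward (_ : _ @^-1` _ = F k)//.
apply/seteqP; split => [x [y Fy /cons_pair_inj <-]//|x Fx].
by exists x.
Qed.

HB.instance Definition _ := Measure_isSigmaFinite.Build _ _ _ tuple_measureS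
  tuple_measureS_sigma_finite.

End TupleCons.

(* n-dimensional Lebesgue measure: the n-fold product of the Lebesgue measure
   on the line, see lebesgue_tuple_box. *)
Fixpoint lebesgue_tuple n : {sigma_finite_measure set (n.-tuple mR) -> \bar R} :=
  match n with
  | 0 => dirac [tuple]
  | n'.+1 => tuple_measureS (lebesgue_tuple n')
  end.

Lemma lebesgue_tuple_box n (A : 'I_n -> set mR) :
  (forall i, measurable (A i)) ->
  lebesgue_tuple n [set t | forall i, A i (tnth t i)] =
  (\prod_(i < n) lebesgue_measure (A i))%E.
Proof.
elim: n A => [|n IHn] A mA.
  rewrite big_ord0 /= diracE mem_set//= => -[].
  by [].
rewrite big_ord_recl -IHn//= /tuple_measureS /pushforward.
rewrite -product_measure1E//; last first.
  rewrite (_ : mkset _ =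
      \bigcap_(i in setT) ((fun t => tnth t i) @^-1` A (lift ord0 i))).
    apply: fin_bigcap_measurable => // i _; rewrite -[X in measurable X]setTI.
    exact: measurable_tnth.
  by apply/seteqP; split => t /= tA i; [move=> _|]; exact: tA.
congr ((_ \x _)%E _); apply/seteqP; split => -[x s] /=.
  move=> xsA; split=> [|i]; first exact: (xsA ord0).
  by have := xsA (lift ord0 i); rewrite tnthS.
move=> [xA sA] i; case: (unliftP ord0 i) => [j|] ->; last exact: xA.
by rewrite tnthS; exact: sA.
Qed.

End TupleMeasure.

Section Ellipsoids.
Variables (R : realType) (d : nat).
Implicit Types A E : set 'rV[R]_d.

Definition volume A : \bar R :=
  lebesgue_tuple R d [set t | A (\row_i tnth t i)].

Definition convex_body A := [/\ convex_set A, compact A & A° !=set0].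

(* The norm of 'rV[R]_d in the library is the sup norm. *)
Definition euclidean_unit_ball : set 'rV[R]_d :=
  [set x | Num.sqrt (\sum_(i < d) x 0 i ^+ 2) <= 1].

Definition ellipsoid E := exists2 M : 'M[R]_d, M \in unitmx &
  exists c : 'rV[R]_d, E = [set x *m M + c | x in euclidean_unit_ball].

Definition contains_unit_ellipsoid A :=
  exists E, [/\ ellipsoid E, volume E = 1%E & E `<=` A].

End Ellipsoids.

(* Main.v *)
From HB Require Import structures.
Require Import Defs.
From mathcomp Require Import all_boot all_order all_algebra.
From mathcomp Require Import all_classical all_reals all_analysis.
From mathcomp Require Import measurable_realfun ring lra.

Set Implicit Arguments.
Unset Strict Implicit.
Unset Printing Implicit Defensive.

Import Order.TTheory GRing.Theory Num.Theory.
Import numFieldNormedType.Exports.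

Local Open Scope classical_set_scope.
Local Open Scope ring_scope.

(** Put N = d(d+3)/2.  By QR decomposition, every ellipsoid is x |-> x T + c
applied to the unit ball, with T upper triangular and positive on the
diagonal; such pairs (T, c) live in a vector space of dimension exactly N.
Two facts make this parametrization linear enough for convex geometry.  The
pairs whose ellipsoid lies in a closed convex set form a closed convex set
([inscribed]).  The volume of the ellipsoid is the product of the diagonal of
T times the volume of the ball ([volume_triangular_image]), so that
volume at least one means that this product is at least some constant v, which
cuts out a closed convex set ([large v], convex by the concavity of the
logarithm).  An ellipsoid of volume at least one can be shrunk
to volume one, hence a set contains an ellipsoid of volume one iff its
inscribed parameters meet [large v] ([contains_unit_ellipsoidP]).

For a family L of bodies let p be the point of least Euclidean norm among
the large parameters inscribed in all members of L.  It is unique, by strict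
convexity of the norm.  The key step ([least_norm_determined]) is that, when
L has N members, some N - 1 of them have the same point p.
Indeed, the convex sets {norm < |p|}, [large v] and the inscribed sets of the
members of L have no common point, so by Helly's theorem in dimension N some
N + 1 of them have none.  Both special sets occur among these N + 1: without
{norm < |p|} the point p is common to all, and without [large v] the point
(0, c) is, where p = (T, c), since it has smaller norm and the one-point
ellipsoid {c} lies wherever the ellipsoid of p does.  So at most N - 1 bodies
are involved, and they already forbid a norm below |p|.  This gain of one over
the bare dimension count gives the sharp number N.

The rest is double counting ([pigeonhole_determining_subset]).  Each of the
at least alpha C(n, N) good N-families is assigned an (N - 1)-subfamily determining its
least-norm point; some J receives at least alpha (n - N + 1) / N of them.  Each comes
from adding to J a body containing the ellipsoid of J.  Together with the
N - 1 members of J, the bodies containing that ellipsoid number at least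
alpha n / N. *)

(** * Convex sets and Helly's theorem *)

Lemma convex_setP (R : realType) (E : lmodType R) (A : set E) :
  convex_set A <-> forall x y (s t : R), 0 <= s -> 0 <= t -> s + t = 1 ->
    A x -> A y -> A (s *: x + t *: y).
Proof.
split => [cA x y s t s0 t0 st Ax Ay|cA x y l /set_mem Ax /set_mem Ay].
  have s1 : s <= 1 by lra.
  have -> : t = 1 - s by lra.
  apply/set_mem; exact: (cA x y (Itv01 s0 s1) (mem_set Ax) (mem_set Ay)).
apply/mem_set; apply: cA => //.
  by rewrite subr_ge0.
by rewrite addrC subrK.
Qed.

Lemma convex_set_bigcap (R : realType) (E : lmodType R) (I : Type)
    (P : set I) (C : I -> set E) :
  (forall i, P i -> convex_set (C i)) -> convex_set (\bigcap_(i in P) C i).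
Proof.
move=> cC; apply/convex_setP => x y s t s0 t0 st Cx Cy i Pi.
by have /convex_setP := cC i Pi; apply=> //; [exact: Cx|exact: Cy].
Qed.

Lemma convex_setI (R : realType) (E : lmodType R) (A B : set E) :
  convex_set A -> convex_set B -> convex_set (A `&` B).
Proof.
move=> /convex_setP cA /convex_setP cB; apply/convex_setP => x y s t s0 t0 st [? ?] [? ?].
by split; [exact: cA|exact: cB].
Qed.

(** The induction runs over pairs (weight, weighted sum), so that a vanishing
partial weight never has to be inverted. *)
Lemma convex_set_sum (R : realType) (E : lmodType R) (A : set E) (J : finType)
    (P : pred J) (w : J -> R) (x : J -> E) :
  convex_set A -> (forall j, P j -> 0 <= w j) -> (forall j, P j -> A (x j)) ->
  0 < \sum_(j | P j) w j ->
  A ((\sum_(j | P j) w j)^-1 *: \sum_(j | P j) w j *: x j).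
Proof.
move=> /convex_setP cA w0 Ax.
pose Q (W : R) (y : E) := (W = 0 /\ y = 0) \/ (0 < W /\ A (W^-1 *: y)).
suff [[-> _]|[]//] : Q (\sum_(j | P j) w j) (\sum_(j | P j) w j *: x j).
  by rewrite ltxx.
apply: (big_ind2 Q) => [|W1 y1 W2 y2|j Pj]; first by left.
  move=> [[-> ->]|[W10 A1]]; first by rewrite !add0r.
  move=> [[-> ->]|[W20 A2]]; first by rewrite !addr0; right.
  have W12 : 0 < W1 + W2 by rewrite addr_gt0.
  right; split => //.
  have -> : (W1 + W2)^-1 *: (y1 + y2) =
      (W1 / (W1 + W2)) *: (W1^-1 *: y1) + (W2 / (W1 + W2)) *: (W2^-1 *: y2).
    rewrite scalerDr !scalerA; congr (_ *: _ + _ *: _); field; lra.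
  apply: cA => //; [by rewrite divr_ge0 // ltW..|].
  by rewrite -mulrDl divff // gt_eqF.
have := w0 j Pj; rewrite le_eqVlt => /predU1P[<-|wj]; first by left; rewrite scale0r.
by right; rewrite scalerA mulVf ?gt_eqF // scale1r; split => //; exact: Ax.
Qed.

(** Prefixing each point with a coordinate 1 turns affine dependence into linear
dependence in dimension N + 1. *)
Lemma affine_dependence (F : fieldType) (N m : nat) (x : 'I_m -> 'rV[F]_N) :
  (N.+1 < m)%N -> exists l : 'I_m -> F,
    [/\ exists j, l j != 0, \sum_j l j = 0 & \sum_j l j *: x j = 0].
Proof.
move=> Nm; pose M : 'M[F]_(m, 1 + N) := \matrix_j row_mx 1 (x j).
have : kermx M != 0.
  rewrite -mxrank_eq0 mxrank_ker subn_eq0 -ltnNge.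
  exact: leq_ltn_trans (rank_leq_col _) Nm.
move=> /rowV0Pn[u /sub_kermxP uM u0].
have E : \sum_j u 0 j *: row_mx 1 (x j) = 0.
  transitivity (u *m M); last exact: uM.
  rewrite mulmx_sum_row; apply: eq_bigr => j _; by rewrite rowK.
exists (u 0); split.
- by case/rV0Pn: u0 => j; exists j.
- have := congr1 (fun v : 'rV__ => lsubmx v 0 0) E.
  rewrite linear_sum summxE linear0 mxE => E0.
  rewrite -[RHS]E0.
  by apply: eq_bigr => j _; rewrite linearZ /= row_mxKl !mxE mulr1.
- have := congr1 rsubmx E; rewrite linear_sum linear0 => E0.
  rewrite -[RHS]E0.
  by apply: eq_bigr => j _; rewrite linearZ /= row_mxKr.
Qed.

(** Splitting an affine dependence by the sign of its coefficients writes one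
and the same point as a convex combination of either part.  Quantifying over
convex sets A expresses membership in both convex hulls. *)
Lemma radon (R : realType) (N m : nat) (x : 'I_m -> 'rV[R]_N) :
  (N.+1 < m)%N -> exists (P : pred 'I_m) (y : 'rV[R]_N),
    forall A, convex_set A ->
      ((forall j, P j -> A (x j)) -> A y) /\
      ((forall j, ~~ P j -> A (x j)) -> A y).
Proof.
move=> /affine_dependence-/(_ _ x)[l [[j0 lj0] l0 lx0]].
pose P j := 0 < l j.
have S0 : 0 < \sum_(j | P j) l j.
  rewrite lt_neqAle sumr_ge0 ?andbT => [|j /ltW//].
  apply: contra_neq lj0 => /esym/eqP S0.
  have lpos j : P j -> l j = 0.
    move=> Pj; apply/eqP; move: S0; rewrite psumr_eq0 => [/allP/(_ j)|i /ltW//].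
    by rewrite mem_index_enum Pj => /(_ isT).
  have lneg j : l j <= 0 by rewrite leNgt; apply/negP => Pj; move: (Pj); rewrite lpos ?ltxx.
  have /eqP : \sum_j - l j = 0 by rewrite sumrN l0 oppr0.
  rewrite psumr_eq0 => [/allP/(_ j0)|j _]; last by rewrite oppr_ge0.
  by rewrite mem_index_enum oppr_eq0 => /(_ isT)/eqP.
exists P, ((\sum_(j | P j) l j)^-1 *: \sum_(j | P j) l j *: x j) => A cA.
split => Ax; first by apply: convex_set_sum => // j /ltW.
have EN : \sum_(j | P j) l j = \sum_(j | ~~ P j) - l j.
  by apply/eqP; rewrite sumrN -addr_eq0 -[X in _ == X]l0 [in X in _ == X](bigID P).
have -> : \sum_(j | P j) l j *: x j = \sum_(j | ~~ P j) (- l j) *: x j.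
  apply/eqP; under [eqbRHS]eq_bigr do rewrite scaleNr.
  by rewrite sumrN -addr_eq0 -[X in _ == X]lx0 [in X in _ == X](bigID P).
rewrite EN in S0 *; apply: convex_set_sum => // j; by rewrite oppr_ge0 -leNgt.
Qed.

(** Induction on the number of sets: dropping C j leaves a common point x j, and
a Radon point of the x j belongs to every C i, because the part of the
partition which avoids i consists of points of C i. *)
Lemma helly_ord (R : realType) (N m : nat) (C : 'I_m -> set 'rV[R]_N) :
  (forall j, convex_set (C j)) ->
  (forall G : {set 'I_m}, (#|G| <= N.+1)%N -> \bigcap_(j in [set` G]) C j !=set0) ->
  \bigcap_j C j !=set0.
Proof.
elim: m C => [|m IHm] C cC CG.
  by have [|x _] := CG finset.set0; [rewrite cards0|exists x => -[]].
have [mN|Nm] := leqP m.+1 N.+1.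
  have [|x Cx] := CG (finset.setTfor 'I_m.+1); first by rewrite cardsT card_ord.
  by exists x => j _; apply: Cx; rewrite /= inE.
have /choice[x Cx] : forall j, exists x, forall i, i != j -> C i x.
  move=> j; have [||y Cy] := IHm (fun i => C (lift j i)); first by [].
    move=> G GN; have [|y Cy] := CG (lift j @: G).
      by rewrite card_imset //; exact: lift_inj.
    by exists y => i Gi; apply: Cy; rewrite /= imset_f.
  by exists y => i; rewrite eq_sym => /unlift_some[k -> _]; exact: Cy.
have [P [y Py]] := @radon R N _ x Nm.
exists y => i _; have [Py1 Py2] := Py _ (cC i).
have [Pi|Pi] := boolP (P i); [apply: Py2 | apply: Py1] => j Pj; apply: Cx.
- by apply: contraTneq Pi => ->.
- by apply: contraNneq Pi => ->.
Qed.

Lemma helly (R : realType) (N : nat) (J : finType) (C : J -> set 'rV[R]_N) :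
  (forall j, convex_set (C j)) ->
  (forall G : {set J}, (#|G| <= N.+1)%N -> \bigcap_(j in [set` G]) C j !=set0) ->
  \bigcap_j C j !=set0.
Proof.
move=> cC CG; have [||x Cx] := @helly_ord R N _ (fun i => C (@enum_val J predT i)).
- by move=> i; exact: cC.
- move=> G GN; have [|x Cx] := CG (enum_val @: G).
    by rewrite card_imset //; exact: enum_val_inj.
  by exists x => i Gi; apply: Cx; rewrite /= imset_f.
- by exists x => j _; rewrite -(enum_rankK j); exact: Cx.
Qed.

(** Superlevel sets of the product are convex on the nonnegative orthant, since
there the logarithm of the product is a concave function. *)
Lemma prod_conv_ge (R : realType) (n : nat) (a b : 'I_n -> R) (v s t : R) :
  0 < v -> 0 <= s -> 0 <= t -> s + t = 1 ->
  (forall i, 0 <= a i) -> (forall i, 0 <= b i) ->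
  v <= \prod_i a i -> v <= \prod_i b i -> v <= \prod_i (s * a i + t * b i).
Proof.
move=> v0 s0 t0 st a0 b0 va vb.
have pos (c : 'I_n -> R) : (forall i, 0 <= c i) -> v <= \prod_i c i -> forall i, 0 < c i.
  move=> c0 vc i; rewrite lt_neqAle c0 andbT eq_sym; apply: contraTneq vc => ci.
  by rewrite (bigD1 i) //= ci mul0r -ltNge.
have s1 : s <= 1 by lra.
have tE : t = 1 - s by lra.
have lnc i : s * ln (a i) + t * ln (b i) <= ln (s * a i + t * b i).
  by rewrite tE; exact: (@concave_ln R (Itv01 s0 s1) _ _ (pos a a0 va i) (pos b b0 vb i)).
have conv0 i : 0 < s * a i + t * b i.
  rewrite tE; exact: (@convR_gt0 R _ _ (Itv01 s0 s1) (pos a a0 va i) (pos b b0 vb i)).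
have lnv (c : 'I_n -> R) : (forall i, 0 <= c i) -> v <= \prod_i c i ->
    ln v <= \sum_i ln (c i).
  move=> c0 vc; rewrite -ler_expR lnK // expR_sum.
  rewrite (_ : \prod_i expR _ = \prod_i c i) //.
  by apply: eq_bigr => i _; rewrite lnK // posrE; exact: (pos _ c0 vc).
rewrite -[v]lnK //.
have -> : \prod_i (s * a i + t * b i) = expR (\sum_i ln (s * a i + t * b i)).
  by rewrite expR_sum; apply: eq_bigr => i _; rewrite lnK // posrE.
rewrite ler_expR; apply: (@le_trans _ _ (s * ln v + t * ln v)).
  by rewrite -mulrDl st mul1r.
apply: (@le_trans _ _ (\sum_i (s * ln (a i) + t * ln (b i)))); last exact: ler_sum.
by rewrite big_split /= -!mulr_sumr lerD // ler_wpM2l // lnv.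
Qed.

(** * QR decomposition *)

Definition sqnorm (R : realType) n (x : 'rV[R]_n) : R := \sum_i x 0 i ^+ 2.

Lemma sqnormE (R : realType) n (x : 'rV[R]_n) : (sqnorm x)%:M = x *m x^T.
Proof.
apply/matrixP => i j; rewrite !ord1 !mxE eqxx mulr1n.
by apply: eq_bigr => k _; rewrite mxE.
Qed.

Lemma sqnorm_ge0 (R : realType) n (x : 'rV[R]_n) : 0 <= sqnorm x.
Proof. by apply: sumr_ge0 => i _; exact: sqr_ge0. Qed.

Lemma sqnorm_eq0 (R : realType) n (x : 'rV[R]_n) : (sqnorm x == 0) = (x == 0).
Proof.
apply/idP/eqP => [|->]; last by apply/eqP/big1 => i _; rewrite mxE expr0n.
rewrite psumr_eq0 => [/allP x0|i _]; last exact: sqr_ge0.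
apply/rowP => i; apply/eqP; rewrite !mxE -sqrf_eq0.
by apply: x0; rewrite mem_index_enum.
Qed.

(** H is the reflection exchanging u and s e, where s is the length of u and e
the first basis vector. *)
Lemma householder (R : realType) n (u : 'cV[R]_(1 + n)) :
  exists (H : 'M[R]_(1 + n)) (s : R),
    [/\ H *m H^T = 1%:M, 0 <= s & H *m u = s *: delta_mx 0 0].
Proof.
pose s := Num.sqrt (sqnorm u^T).
have s0 : 0 <= s by exact: sqrtr_ge0.
pose e : 'cV[R]_(1 + n) := delta_mx 0 0.
pose v := u - s *: e.
have [v0|v0] := eqVneq v 0.
  exists 1%:M, s; split => //; first by rewrite mul1mx trmx1.
  by rewrite mul1mx; apply/subr0_eq.
pose q := sqnorm v^T.
have q0 : q != 0 by rewrite sqnorm_eq0 trmx_eq0.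
have vv : v^T *m v = q%:M by rewrite sqnormE trmxK.
have ue : e^T *m u = (u 0 0)%:M.
  apply/matrixP => i j; rewrite !ord1 trmx_delta -rowE !mxE eqxx mulr1n //.
have eu : u^T *m e = (u 0 0)%:M by apply: trmx_inj; rewrite trmx_mul trmxK ue tr_scalar_mx.
have ee : e^T *m e = 1%:M.
  by rewrite trmx_delta mul_delta_mx; apply/matrixP => i j; rewrite !ord1 !mxE eqxx.
have uu : u^T *m u = (s ^+ 2)%:M by rewrite sqr_sqrtr ?sqnorm_ge0 // sqnormE trmxK.
have vu : v^T *m u = (q / 2)%:M.
  have vu : v^T *m u = (s ^+ 2 - s * u 0 0)%:M.
    by rewrite linearB linearZ /= mulmxBl -scalemxAl uu ue scale_scalar_mx -raddfB.
  have ve : v^T *m e = (u 0 0 - s)%:M.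
    rewrite linearB linearZ /= mulmxBl -scalemxAl eu ee scale_scalar_mx mulr1.
    by rewrite -raddfB.
  rewrite vu; congr _%:M.
  have : q%:M = (2 * (s ^+ 2 - s * u 0 0))%:M :> 'M[R]_(1, 1).
    rewrite -vv {2}/v mulmxBr vu -scalemxAr ve scale_scalar_mx -raddfB /=.
    by congr _%:M; ring.
  by move=> /matrixP/(_ 0 0); rewrite !mxE eqxx !mulr1n => ->; field.
have uv : u - v = s *: e by rewrite opprB addrC subrK.
clearbody v.
pose H := 1%:M - (2 / q) *: (v *m v^T).
have HT : H^T = H.
  by rewrite linearB linearZ /= trmx1 trmx_mul trmxK.
exists H, s; split => //.
- rewrite HT /H mulmxBr mulmx1 -scalemxAr mulmxBl mul1mx -scalemxAl.
  rewrite -mulmxA (mulmxA v^T) vv mul_scalar_mx -scalemxAr scalerA.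
  rewrite (_ : 2 / q * q = 2); last by field.
  rewrite -addrA -[RHS]addr0; congr (_ + _).
  rewrite scalerBr opprB scalerA mulrC -scaleNr -!scalerDl.
  by rewrite [X in X *: _](_ : _ = 0) ?scale0r //; ring.
- rewrite /H mulmxBl mul1mx -scalemxAl -mulmxA vu mul_mx_scalar scalerA.
  rewrite (_ : 2 / q * (q / 2) = 1); last by field.
  by rewrite scale1r.
Qed.

Definition upper_triangular (R : realType) n (T : 'M[R]_n) :=
  forall i j : 'I_n, (j < i)%N -> T i j = 0.

Lemma QR_decomposition (R : realType) n (M : 'M[R]_n) :
  exists Q T : 'M[R]_n, [/\ Q *m Q^T = 1%:M, M = Q *m T,
    upper_triangular T & forall i, 0 <= T i i].
Proof.
elim: n M => [|n IHn] M.
  by exists 1%:M, M; split => [||[]|[]] //; rewrite ?trmx1 mul1mx.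
have [H [s [HH s0 Hu]]] := @householder R n (col 0 M).
pose W : 'M[R]_(1 + n) := H *m M.
have [Q [T [QQ QT uT T0]]] := IHn (drsubmx W).
pose T1 : 'M[R]_(1 + n) := block_mx s%:M (ursubmx W) 0 T.
pose Q1 : 'M[R]_(1 + n) := block_mx 1%:M 0 0 Q.
have HM : W = block_mx s%:M (ursubmx W) 0 (Q *m T).
  rewrite -QT -{1}(submxK W); congr (block_mx _ _ _ _).
    apply/matrixP => i j; rewrite !ord1 !mxE eqxx.
    move/matrixP/(_ 0 0) : Hu; rewrite !mxE eqxx mulr1 /= => <-.
    by apply: eq_bigr => k _; rewrite !mxE; congr (H _ _ * M _ _); exact: val_inj.
  apply/matrixP => i j; rewrite !ord1 !mxE.
  move/matrixP/(_ (rshift 1 i) 0) : Hu; rewrite !mxE /= mulr0 => E0.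
  rewrite -[RHS]E0.
  by apply: eq_bigr => k _; rewrite !mxE; congr (H _ _ * M _ _); exact: val_inj.
exists (H^T *m Q1), T1; split.
- have QQ1 : Q1 *m Q1^T = 1%:M.
    rewrite tr_block_mx mulmx_block !trmx0 !mulmx0 !mul0mx QQ !addr0 !add0r trmx1 mulmx1.
    by rewrite -scalar_mx_block.
  rewrite trmx_mul trmxK mulmxA -(mulmxA H^T) QQ1 mulmx1.
  exact: mulmx1C.
- have Q1T1 : Q1 *m T1 = W.
    rewrite {1}HM /Q1 /T1 mulmx_block.
    by rewrite !mulmx0 !mul0mx !addr0 !add0r !mul1mx.
  rewrite -[RHS](mulmxA H^T Q1 T1) Q1T1 /W mulmxA (mulmx1C HH) mul1mx //.
- move=> i j; rewrite -[i](@splitK 1 n) -[j](@splitK 1 n).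
  case: (@fintype.split 1 n i) => a; case: (@fintype.split 1 n j) => b /=.
  + by rewrite !ord1.
  + by rewrite ord1.
  + by move=> _; rewrite [LHS](block_mxEdl s%:M (ursubmx W) 0 T) mxE.
  + by move=> ba; rewrite [LHS](block_mxEdr s%:M (ursubmx W) 0 T) uT.
- move=> i; rewrite -[i](@splitK 1 n); case: (@fintype.split 1 n i) => a /=.
  + by rewrite [leRHS](block_mxEul s%:M (ursubmx W) 0 T) !ord1 mxE eqxx.
  + by rewrite [leRHS](block_mxEdr s%:M (ursubmx W) 0 T).
Qed.

(** * Lebesgue measure under triangular affine maps *)

Section Affine1.
Variables (R : realType) (a b : R).
Hypothesis a0 : 0 < a.
Local Notation mR := (measurableTypeR R).
Local Notation mu := (@lebesgue_measure R).

Let phi (x : mR) : mR := a * x + b.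

Let mphi : measurable_fun setT phi.
Proof.
apply: measurable_funD; last exact: measurable_cst.
by apply: measurable_funM; [exact: measurable_cst|exact: measurable_id].
Qed.

Let pf : {measure set mR -> \bar R} :=
  measure_function_pushforward__canonical__measure_function_Measure mu mphi.

Lemma lebesgue_measure_affine (B : set mR) : measurable B ->
  mscale (NngNum (ltW a0)) pf B = mu B.
Proof.
move=> mB; apply/esym.
apply: (@lebesgue_measure_unique R (mscale (NngNum (ltW a0)) pf)) => // _ [[u v] _ <-] /=.
rewrite /mscale /= /pushforward.
have -> : phi @^-1` `]u, v]%classic = `](u - b) / a, (v - b) / a]%classic.
  apply/seteqP; split => x /=; rewrite !in_itv /= /phi ltr_pdivrMr // ler_pdivlMr //;
  by rewrite ltrBlDr lerBrDr (mulrC x).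
rewrite !lebesgue_measure_itv /= !lte_fin ltr_pM2r ?invr_gt0 // ltrD2r.
case: ifPn => _; last by rewrite mule0.
rewrite -!EFinD -EFinM; congr _%:E; field; rewrite gt_eqF //.
Qed.

(** The scaled push-forward of Lebesgue measure under x |-> a x + b is Lebesgue
measure again, which turns the change of variables into a transfer of
integrals. *)
Lemma integral_affine (g : mR -> \bar R) :
  measurable_fun setT g -> (forall x, 0 <= g x)%E ->
  (a%:E * \int[mu]_x g (a * x + b)%R = \int[mu]_x g x)%E.
Proof.
move=> mg g0; rewrite -(@ge0_integral_pushforward _ _ _ _ R phi mphi mu setT g) //.
rewrite -(@ge0_integral_mscale _ _ _ pf setT _ (NngNum (ltW a0))) //.
by apply: eq_measure_integral => B mB _; exact: lebesgue_measure_affine.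
Qed.

End Affine1.

Section AffineTuple.
Variable R : realType.
Local Notation mR := (measurableTypeR R).

Definition affine_tuple n (T : 'M[R]_n) (c : 'rV[R]_n) (t : n.-tuple mR) : n.-tuple mR :=
  [tuple \sum_i tnth t i * T i j + c 0 j | j < n].

Lemma measurable_affine_tuple n (T : 'M[R]_n) (c : 'rV[R]_n) :
  measurable_fun setT (affine_tuple T c).
Proof.
apply/measurable_fun_tnthP => j.
rewrite (_ : _ \o _ = fun t => \sum_i tnth t i * T i j + c 0 j); last first.
  by apply/funext => t /=; rewrite tnth_mktuple.
apply: measurable_funD; last exact: measurable_cst.
apply: measurable_sum => i; apply: measurable_funM; last exact: measurable_cst.
exact: measurable_tnth.
Qed.

(** Since T is upper triangular, the first coordinate of the image depends on
the first coordinate alone, and over a fixed first coordinate the map is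
triangular affine in the others.  So Fubini's theorem reduces the claim to
dimension n and to the change of variables on the line. *)
Lemma lebesgue_tuple_triangular n (T : 'M[R]_n) (c : 'rV[R]_n) (B : set (n.-tuple mR)) :
  upper_triangular T -> (forall i, 0 < T i i) -> measurable B ->
  ((\prod_i T i i)%:E * lebesgue_tuple R n (affine_tuple T c @^-1` B) =
  lebesgue_tuple R n B)%E.
Proof.
elim: n T c B => [|n IHn] T c B uT T0 mB.
  rewrite big_ord0 mul1e; congr (lebesgue_tuple _ _ _).
  by apply/seteqP; split => t; rewrite /= (tuple0 (affine_tuple _ _ _)) (tuple0 t).
pose T1 : 'M[R]_n := \matrix_(i, j) T (lift 0 i) (lift 0 j).
pose c1 x : 'rV[R]_n := \row_j (x * T 0 (lift 0 j) + c 0 (lift 0 j)).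
have uT1 : upper_triangular T1 by move=> i j ij; rewrite mxE uT.
have T10 i : 0 < T1 i i by rewrite mxE.
pose B1 x := xsection (@cons_pair R n @^-1` B) x.
have mcB : measurable (@cons_pair R n @^-1` B).
  by rewrite -[X in measurable X]setTI; exact: measurable_cons_pair.
have mB1 x : measurable (B1 x) by exact: measurable_xsection.
have fE x s : affine_tuple T c (cons_pair (x, s)) =
    cons_pair (T 0 0 * x + c 0 0, affine_tuple T1 (c1 x) s).
  apply: eq_from_tnth => j; rewrite tnth_mktuple big_ord_recl /=.
  case: (unliftP ord0 j) => [k|] ->; rewrite ?tnth0 ?tnthS.
    rewrite tnth_mktuple !mxE -addrA addrCA; congr (_ + _).
    by apply: eq_bigr => i _; rewrite tnthS mxE.
  rewrite big1 ?addr0; first by rewrite mulrC.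
  by move=> i _; rewrite uT ?mulr0.
have E x : xsection (@cons_pair R n @^-1` (affine_tuple T c @^-1` B)) x =
    affine_tuple T1 (c1 x) @^-1` B1 (T 0 0 * x + c 0 0).
  by apply/seteqP; split => s; rewrite /B1 /xsection /= !inE /= fE.
rewrite big_ord_recl EFinM /= /tuple_measureS /pushforward /product_measure1 /=.
have mg : measurable_fun setT (lebesgue_tuple R n \o B1).
  exact: measurable_fun_xsection.
have P0 : 0 < \prod_(i < n) T (lift 0 i) (lift 0 i) by apply: prodr_gt0 => i _; exact: T0.
rewrite -muleA -[RHS](@integral_affine R (T 0 0) (c 0 0)) //.
congr (_ * _)%E; rewrite -ge0_integralZl //; last 2 first.
- rewrite (_ : (fun x => _) = (lebesgue_tuple R n \o
      xsection (@cons_pair R n @^-1` (affine_tuple T c @^-1` B)))) //.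
  apply: measurable_fun_xsection.
  rewrite -[X in measurable X]setTI; apply: measurable_cons_pair => //.
  by rewrite -[X in measurable X]setTI; exact: measurable_affine_tuple.
- by rewrite lee_fin ltW.
apply: eq_integral => x _; rewrite /= E -[RHS](IHn T1 (c1 x)) //.
by congr (_%:E * _)%E; apply: eq_bigr => i _; rewrite mxE.
Qed.
End AffineTuple.

Section Volume.
Variables (R : realType) (n : nat).
Local Notation mR := (measurableTypeR R).

Lemma euclidean_unit_ballE (x : 'rV[R]_n) : euclidean_unit_ball x <-> sqnorm x <= 1.
Proof.
by rewrite /euclidean_unit_ball /= -{1}(@sqrtr1 R) ler_sqrt.
Qed.

Lemma row_affine_tuple (T : 'M[R]_n) (c : 'rV[R]_n) (t : n.-tuple mR) :
  \row_i tnth (affine_tuple T c t) i = (\row_i tnth t i) *m T + c.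
Proof.
apply/rowP => j; rewrite mxE tnth_mktuple !mxE; congr (_ + _).
by apply: eq_bigr => i _; rewrite mxE.
Qed.

Lemma measurable_ball_tuple :
  measurable [set t : n.-tuple mR | euclidean_unit_ball (\row_i tnth t i)].
Proof.
have mf : measurable_fun setT (fun t : n.-tuple mR => \sum_i (tnth t i) ^+ 2).
  by apply: measurable_sum => i; apply: measurable_funX; exact: measurable_tnth.
rewrite (_ : mkset _ = (fun t : n.-tuple mR => \sum_i (tnth t i) ^+ 2) @^-1` `]-oo, 1]%classic).
  by rewrite -[X in measurable X]setTI; apply: mf => //; exact: measurable_itv.
apply/seteqP; split => t /=; rewrite in_itv /=.
  move/euclidean_unit_ballE; apply: le_trans.
  by rewrite le_eqVlt; apply/orP; left; apply/eqP/eq_bigr => i _; rewrite mxE.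
move=> t1; apply/euclidean_unit_ballE; apply: le_trans t1.
by rewrite le_eqVlt; apply/orP; left; apply/eqP/eq_bigr => i _; rewrite mxE.
Qed.

Lemma upper_triangular_det (T : 'M[R]_n) :
  upper_triangular T -> \det T = \prod_i T i i.
Proof.
move=> uT; rewrite -det_tr det_trig; first by apply: eq_bigr => i _; rewrite mxE.
by apply/is_trig_mxP => i j ij; rewrite mxE uT.
Qed.

(** The image is the preimage of the ball under the inverse affine map, hence
measurable, and its own preimage under x |-> x T + c is the ball. *)
Lemma volume_triangular_image (T : 'M[R]_n) (c : 'rV[R]_n) :
  upper_triangular T -> (forall i, 0 < T i i) ->
  volume [set x *m T + c | x in @euclidean_unit_ball R n] =
  ((\prod_i T i i)%:E * volume (@euclidean_unit_ball R n))%E.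
Proof.
move=> uT T0; have Tu : T \in unitmx.
  by rewrite unitmxE upper_triangular_det // unitfE gt_eqF // prodr_gt0.
have EB (y : 'rV[R]_n) : [set x *m T + c | x in @euclidean_unit_ball R n] y <->
    euclidean_unit_ball (y *m invmx T + - (c *m invmx T)).
  rewrite -mulmxBl; split => [[x Bx <-]|By]; first by rewrite addrK mulmxK.
  by exists ((y - c) *m invmx T); rewrite ?mulmxKV // subrK.
rewrite /volume -(@lebesgue_tuple_triangular _ _ T c) //.
- congr (_ * lebesgue_tuple _ _ _)%E; apply/seteqP; split => t /=; rewrite row_affine_tuple.
  + by move/EB; rewrite mulmxDl addrK mulmxK.
  + by exists (\row_i tnth t i).
- rewrite (_ : mkset _ = affine_tuple (invmx T) (- (c *m invmx T)) @^-1`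
      [set t : n.-tuple mR | euclidean_unit_ball (\row_i tnth t i)]); last first.
    by apply/seteqP; split => t /=; rewrite row_affine_tuple => /EB.
  rewrite -[X in measurable X]setTI; apply: measurable_affine_tuple => //.
  exact: measurable_ball_tuple.
Qed.
End Volume.

(** * Counting determining subfamilies *)

Lemma subset_of_card_between (T : finType) (A B : {set T}) (k : nat) :
  A \subset B -> (#|A| <= k <= #|B|)%N ->
  exists C : {set T}, [/\ A \subset C, C \subset B & #|C| = k].
Proof.
elim: k => [|k IHk] AB /andP[Ak kB].
  by exists A; split => //; apply/eqP; rewrite -leqn0.
move: Ak; rewrite leq_eqVlt => /predU1P[<-|]; first by exists A.
rewrite ltnS => Ak.
have [|C [AC CB Ck]] := IHk AB; first by rewrite Ak ltnW.
have /fintype.subsetPn[x xB xC] : ~~ (B \subset C).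
  by apply: contraL kB => /subset_leq_card; rewrite Ck -ltnNge ltnS.
exists (x |: C); split.
- by rewrite (fintype.subset_trans AC) // finset.subsetUr.
- by rewrite finset.subUset finset.sub1set xB.
- by rewrite cardsU1 xC Ck.
Qed.

Lemma card_extensions (I : finType) (J S : {set I}) :
  (#|[set L : {set I} | [&& J \subset L, #|L| == #|J|.+1 & L \subset S]]%SET| <=
   #|S :\: J|)%N.
Proof.
apply: leq_trans (leq_imset_card (fun i => i |: J) _); apply/subset_leq_card/fintype.subsetP => L.
rewrite inE => /and3P[JL /eqP cL LS].
have : (#|L :\: J| == 1)%N by rewrite cardsD (finset.setIidPr JL) cL subSnn.
move=> /cards1P[i Li].
have Eli : L = i |: J by rewrite -[LHS](finset.setID L J) (finset.setIidPr JL) Li finset.setUC.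
apply/imsetP; exists i => //.
have : i \in L :\: J by rewrite Li finset.in_set1.
by rewrite !finset.in_setD => /andP[-> /(fintype.subsetP LS)].
Qed.

(** [S J] stands for the members lying over the object determined by J.  Every
good L is determined by some J of size k inside it; the sets L assigned to
the same J are of the form J plus one element of [S J], so that
[S J] has at least k more elements than there are such L. *)
Lemma pigeonhole_determining_subset (R : realFieldType) (I : finType) (k : nat) (alpha : R)
    (good : {set {set I}}) (S : {set I} -> {set I}) :
  0 < alpha <= 1 -> (k < #|I|)%N ->
  (forall L, L \in good -> #|L| = k.+1 /\
     exists J : {set I}, [/\ J \subset L, #|J| = k & L \subset S J]) ->
  alpha * 'C(#|I|, k.+1)%:R <= #|good|%:R ->
  exists (J L : {set I}), [/\ L \in good, J \subset L, #|J| = k &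
    alpha * #|I|%:R <= k.+1%:R * #|S J|%:R].
Proof.
move=> /andP[a0 a1] kn goodP le_good.
pose phi (L : {set I}) : {set I} := odflt finset.set0
  [pick J : {set I} | [&& J \subset L, #|J| == k & L \subset S J]].
have phiP (L : {set I}) : L \in good ->
    [/\ phi L \subset L, #|phi L| = k & L \subset S (phi L)].
  move=> /goodP[_ [J [JL cJ LS]]]; rewrite /phi; case: pickP => [J1 /and3P[? /eqP ? ?]//|/(_ J)].
  by rewrite JL cJ eqxx LS.
have [//|nE] := pselect (exists (J L : {set I}), [/\ L \in good, J \subset L, #|J| = k &
    alpha * #|I|%:R <= k.+1%:R * #|S J|%:R]).
exfalso; move: le_good; apply/negP; rewrite -ltNge.
pose F (J : {set I}) : {set {set I}} := finset.finset (fun L => (L \in good) && (phi L == J)).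
have fibre (J : {set I}) : (#|J| == k)%N -> k.+1%:R * #|F J|%:R < alpha * (#|I| - k)%:R.
  move=> /eqP cJ; have [->|/finset.set0Pn[L]] := eqVneq (F J) finset.set0.
    by rewrite cards0 mulr0 mulr_gt0 // ltr0n subn_gt0.
  rewrite inE => /andP[gL /eqP pL]; have [JL _ LS] := phiP L gL.
  rewrite pL in JL LS.
  (* The contradiction hypothesis applies to J since the fibre is inhabited. *)
  have SJ : k.+1%:R * #|S J|%:R < alpha * #|I|%:R.
    by rewrite ltNge; apply/negP => le; apply: nE; exists J, L.
  have : (#|F J| <= #|S J :\: J|)%N.
    apply: leq_trans (card_extensions _ _); apply/subset_leq_card/fintype.subsetP => M.
    rewrite !inE => /andP[gM /eqP <-]; have [-> -> ->] := phiP M gM.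
    by have [-> _] := goodP M gM; rewrite eqxx.
  rewrite cardsD (finset.setIidPr (fintype.subset_trans JL LS)) cJ leq_subRL; last first.
    by rewrite -cJ subset_leq_card // (fintype.subset_trans JL LS).
  rewrite -(ler_nat R) natrD natrB; last exact: ltnW.
  move: SJ; rewrite -[k.+1]addn1 natrD.
  have : 0 <= k%:R :> R by [].
  move: (k%:R : R) (#|F J|%:R : R) (#|S J|%:R : R) (#|I|%:R : R) => x f s n; nra.
have card_good : #|good| = (\sum_(J : {set I} | #|J| == k) #|F J|)%N.
  rewrite -sum1_card (partition_big phi (fun J => #|J| == k)) /=; last first.
    by move=> L /phiP[_ -> _].
  by apply: eq_bigr => J _; rewrite -sum1_card; apply: eq_bigl => L; rewrite inE.
have k0 : 0 < k.+1%:R :> R by rewrite ltr0n.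
rewrite -(ltr_pM2l k0) [ltRHS]mulrCA -[X in _ < _ * X]natrM mul_bin_left natrM mulrA.
rewrite card_good natr_sum mulr_sumr.
have -> : alpha * (#|I| - k)%:R * 'C(#|I|, k)%:R =
    \sum_(J : {set I} | #|J| == k) alpha * (#|I| - k)%:R.
  rewrite sumr_const mulr_natr; congr (_ *+ _).
  rewrite -card_draws; apply: eq_card => J; rewrite !inE //.
apply: ltr_sum => //.
have : (0 < #|[set J : {set I} | #|J| == k]%SET|)%N.
  by rewrite card_draws bin_gt0 ltnW.
by case/card_gt0P => J; rewrite inE => cJ; apply/hasP; exists J; rewrite ?mem_index_enum.
Qed.

(** * Points of least norm *)

Section LeastNorm.
Variables (R : realType) (N : nat).
Implicit Types (A : set 'rV[R]_N) (p q : 'rV[R]_N).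

Lemma sqnorm_continuous : continuous (@sqnorm R N).
Proof.
move=> p; apply: (cvg_big _ (nbhs_filter p)) => [|i _]; first exact: add_continuous.
apply: (@cvg_comp _ _ _ _ (fun x : R => x ^+ 2)); first exact: coord_continuous.
exact: exprn_continuous.
Qed.

Lemma linear_continuous_rV (V : normedModType R) (f : {linear 'rV[R]_N -> V}) :
  continuous f.
Proof.
have fE p : f p = \sum_k p 0 k *: f (delta_mx 0 k).
  rewrite {1}(row_sum_delta p) linear_sum.
  by apply: eq_bigr => k _; rewrite linearZ.
rewrite (funext fE) => p; apply: (cvg_big _ (nbhs_filter p)) => [|k _]; first exact: add_continuous.
by apply: cvgZr_tmp; exact: coord_continuous.
Qed.

Definition is_least_norm A p := A p /\ forall q, A q -> sqnorm p <= sqnorm q.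

Definition least_norm A := xget 0 [set p | is_least_norm A p].

Lemma least_normP A : closed A -> A !=set0 -> is_least_norm A (least_norm A).
Proof.
move=> cA [p0 Ap0]; apply: (@xgetPex _ _ [set p | is_least_norm A p]).
pose B := A `&` [set p | sqnorm p <= sqnorm p0].
pose M := sqnorm p0 + 1.
have cB : compact B.
  have clB : closed B.
    apply: closedI => //.
    apply: ((continuous_closedP (@sqnorm R N)).1 sqnorm_continuous [set x | x <= sqnorm p0]).
    exact: closed_le.
  have cube : compact [set p : 'rV[R]_N | forall i, p ord0 i \in `[- M, M]].
    apply: (@rV_compact _ _ (fun=> `[- M, M]%classic)) => _.
    exact: segment_compact.
  apply: subclosed_compact clB cube _ => p [_ /= pM] i; rewrite in_itv /= -ler_norml.
  have : `|p ord0 i| ^+ 2 <= sqnorm p0.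
    apply: le_trans pM; rewrite real_normK ?num_real // /sqnorm (bigD1 i) //= lerDl.
    by apply: sumr_ge0 => j _; exact: sqr_ge0.
  have := normr_ge0 (p ord0 i); have := sqnorm_ge0 p0; rewrite /M.
  move: (sqnorm p0) `|p ord0 i| => s x; nra.
have B0 : B !=set0 by exists p0; split => //=.
have [p /set_mem[Ap pp0] pmin] : exists2 p, p \in B & forall q, q \in B -> sqnorm p <= sqnorm q.
  apply: EVT_min_rV => //; apply: continuous_subspaceT; exact: sqnorm_continuous.
exists p; split => // q Aq; have [qp0|/ltW] := leP (sqnorm q) (sqnorm p0).
  by apply: pmin; apply/mem_set.
exact: le_trans.
Qed.

Lemma sqnorm_parallelogram p q :
  sqnorm (2^-1 *: p + 2^-1 *: q) =
  2^-1 * sqnorm p + 2^-1 * sqnorm q - 4^-1 * sqnorm (p - q).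
Proof.
rewrite /sqnorm !mulr_sumr -big_split -sumrB /=; apply: eq_bigr => i _.
by rewrite !mxE; field.
Qed.

(** The midpoint of two distinct points of equal norm is strictly shorter. *)
Lemma is_least_norm_unique A p q :
  convex_set A -> is_least_norm A p -> is_least_norm A q -> p = q.
Proof.
move=> /convex_setP cA [Ap pmin] [Aq qmin].
apply/eqP; rewrite -subr_eq0 -sqnorm_eq0 eq_le sqnorm_ge0 andbT.
have Am : A (2^-1 *: p + 2^-1 *: q) by apply: cA => //; lra.
have := pmin _ Am; have := pmin _ Aq; have := qmin _ Ap; rewrite sqnorm_parallelogram.
by move: (sqnorm p) (sqnorm q) (sqnorm (p - q)) => x y z; lra.
Qed.

Lemma convex_set_sqnorm_lt r : convex_set [set p : 'rV[R]_N | sqnorm p < r].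
Proof.
apply/convex_setP => p q s t s0 t0 st /= pr qr.
have -> : sqnorm (s *: p + t *: q) = s * sqnorm p + t * sqnorm q - s * t * sqnorm (p - q).
  rewrite /sqnorm !mulr_sumr -big_split -sumrB /=; apply: eq_bigr => i _.
  rewrite !mxE; have -> : t = 1 - s by lra.
  by ring.
have := sqnorm_ge0 (p - q); have : 0 <= s * t by rewrite mulr_ge0.
move: (sqnorm p) (sqnorm q) (sqnorm (p - q)) pr qr => x y z xr yr st0 z0.
have stz : 0 <= s * t * z by rewrite mulr_ge0.
have mr : Num.max x y < r by rewrite gt_max xr.
have sx : s * x <= s * Num.max x y by rewrite ler_wpM2l // le_max lexx.
have ty : t * y <= t * Num.max x y by rewrite ler_wpM2l // le_max lexx orbT.
have : s * Num.max x y + t * Num.max x y = Num.max x y by rewrite -mulrDl st mul1r.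
lra.
Qed.

End LeastNorm.

Section Determining.
Variables (R : realType) (N : nat) (I : finType).
Variables (K : I -> set 'rV[R]_N) (D : set 'rV[R]_N).
(** In the application [flat] shrinks an ellipsoid to its center. *)
Variable (flat : 'rV[R]_N -> 'rV[R]_N).
Hypotheses (cvxK : forall i, convex_set (K i)) (cvxD : convex_set D).
Hypotheses (closedK : forall i, closed (K i)) (closedD : closed D).
Hypothesis flatK : forall i p, K i p -> K i (flat p).
Hypothesis flatD : forall p, D p -> sqnorm (flat p) < sqnorm p.

Definition feasible (J : {set I}) := \bigcap_(i in [set` J]) K i `&` D.

Lemma least_norm_feasible J : feasible J !=set0 ->
  is_least_norm (feasible J) (least_norm (feasible J)).
Proof.
by apply: least_normP; apply: closedI => //; apply: closed_bigI => i _; exact: closedK.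
Qed.

(** Helly's theorem for the sets {norm < |p|}, D and K i for i in L, indexed by
None, Some None and Some (Some i): a subfamily of N + 1 sets without common
point must contain the first two. *)
Lemma least_norm_determined (L : {set I}) : (0 < N)%N -> #|L| = N -> feasible L !=set0 ->
  exists J : {set I}, [/\ J \subset L, #|J| = N.-1 &
    least_norm (feasible J) = least_norm (feasible L)].
Proof.
move=> N0 cL /least_norm_feasible; set p := least_norm _ => -[[Kp Dp] pmin].
pose X (o : option (option I)) := match o with
  | None => [set q | sqnorm q < sqnorm p]
  | Some None => D
  | Some (Some i) => if i \in L then K i else setT
  end.
have [G [cG G0]] : exists G : {set option (option I)},
    (#|G| <= N.+1)%N /\ ~ (\bigcap_(o in [set` G]) X o !=set0).
  apply: contrapT => /forallNP nG.
  have [||q Xq] := @helly R N _ X.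
  - case=> [[i|]|] //=; last exact: convex_set_sqnorm_lt.
    by case: ifP => // _; apply/convex_setP.
  - by move=> G cG; apply: contrapT => G0; exact: (nG G).
  have := Xq None Logic.I; apply/negP; rewrite -leNgt; apply: pmin; split.
    by move=> i Li; have := Xq (Some (Some i)) Logic.I; rewrite /= Li.
  exact: (Xq (Some None) Logic.I).
(* Otherwise p itself is a common point of the family G. *)
have GNone : None \in G.
  apply/negPn/negP => nG; apply: G0; exists p => -[[i|]|] //= Go.
  - by case: ifP => // Li; exact: Kp.
  - by rewrite Go in nG.
(* Otherwise flat p is a common point of the family G. *)
have GD : Some None \in G.
  apply/negPn/negP => nG; apply: G0; exists (flat p) => -[[i|]|] //= Go.
  - by case: ifP => // Li; apply: flatK; exact: Kp.
  - by rewrite Go in nG.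
  - exact: flatD.
pose J1 := [set i in L | Some (Some i) \in G]%SET.
have J1L : J1 \subset L by apply/fintype.subsetP => i; rewrite inE => /andP[].
have cJ1 : (#|J1| <= N.-1)%N.
  rewrite -ltnS prednK // -ltnS; apply: leq_trans cG.
  pose S := [set Some (Some i) | i in J1]%SET.
  have nSome : Some None \notin S by apply/imsetP => -[].
  have nNone : None \notin (Some None |: S)%SET.
    by rewrite !inE /=; apply/imsetP => -[].
  have <- : #|(None |: (Some None |: S))%SET| = #|J1|.+2.
    by rewrite !cardsU1 nNone nSome card_imset => // i j [->].
  apply/subset_leq_card/fintype.subsetP => o; rewrite !inE => /or3P[/eqP->//|/eqP->//|].
  by case/imsetP => i; rewrite inE => /andP[_ ?] ->.
have [|J [J1J JL cJ]] := @subset_of_card_between _ _ _ N.-1 J1L.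
  by rewrite cJ1 cL leq_pred.
exists J; split => //.
have pJ : feasible J p by split => // i Ji; apply: Kp; apply: (fintype.subsetP JL).
have [[Kq Dq] qmin] := least_norm_feasible (ex_intro _ p pJ).
set q := least_norm _ in Kq Dq qmin *.
apply: (@is_least_norm_unique _ _ (feasible J)).
- by apply: convex_setI => //; exact: convex_set_bigcap.
- by split => //.
split=> // r Jr; apply: le_trans (qmin _ Jr); rewrite leNgt; apply/negP => qp.
apply: G0; exists q => -[[i|]|] //= Go.
case: ifP => // Li; apply: Kq; apply: (fintype.subsetP J1J).
by rewrite inE Li.
Qed.

End Determining.

(** * The parameter space of ellipsoids *)

(** Index (j, i) of the entry in row i and column j of the (d+1) x d matrix
obtained by putting the row vector c on top of the upper triangular T:
row 0 is full, and row i > 0 starts at column i - 1. *)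
Definition coordinate d := {u : 'I_d * 'I_d.+1 | (u.2 <= u.1.+1)%N}.

Lemma double_card_coordinate d : (2 * #|{: coordinate d}| = d * (d + 3))%N.
Proof.
rewrite card_sig -sum1_card.
rewrite -(@pair_big_dep _ _ _ _ _ predT
  (fun (j : 'I_d) (i : 'I_d.+1) => (i <= j.+1)%N) (fun _ _ => 1%N)) /=.
have E (j : 'I_d) : (\sum_(i < d.+1 | i <= j.+1) 1 = j + 2)%N.
  under eq_bigl do rewrite -ltnS.
  rewrite -(big_ord_widen d.+1 (fun=> 1%N)) ?sum1_card ?card_ord ?addn2 //.
  by rewrite ltnS; exact: ltn_ord.
under eq_bigr do rewrite E.
elim: d {E} => [|d IHd]; first by rewrite big_ord0.
by rewrite big_ord_recr /= mulnDr IHd; ring.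
Qed.

Section EllipsoidCoordinates.
Variables (R : realType) (d : nat).
Local Notation N := #|{: coordinate d}|.
Implicit Types (p q : 'rV[R]_N) (A : set 'rV[R]_d).

(** The default value 0 fills the part of T below the diagonal. *)
Definition entry p (i : 'I_d.+1) (j : 'I_d) : R :=
  oapp (fun u : coordinate d => p 0 (enum_rank u)) 0 (insub (j, i)).

Definition offset p : 'rV[R]_d := \row_j entry p ord0 j.

Definition triangle p : 'M[R]_d := \matrix_(i, j) entry p (lift ord0 i) j.

Definition stacked_entry (T : 'M[R]_d) (c : 'rV[R]_d) (u : 'I_d * 'I_d.+1) : R :=
  oapp (fun i => T i u.1) (c 0 u.1) (unlift ord0 u.2).

Definition parameter (T : 'M[R]_d) (c : 'rV[R]_d) : 'rV[R]_N :=
  \row_k stacked_entry T c (\val (enum_val k : coordinate d)).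

Lemma entry_linear i j : linear (fun p => entry p i j : R^o).
Proof.
move=> a p q; rewrite /entry; case: insubP => [u _ _|_] /=; first by rewrite !mxE.
by rewrite scaler0 addr0.
Qed.

Lemma entry_continuous i j : continuous (fun p => entry p i j).
Proof.
rewrite /entry; case: insubP => [u _ _|_] /=; first exact: coord_continuous.
exact: cst_continuous.
Qed.

Lemma triangle_upper p : upper_triangular (triangle p).
Proof.
move=> i j ji; rewrite mxE /entry insubF //=.
by rewrite /bump /= add1n ltnS leqNgt ji.
Qed.

Lemma parameterK T c : upper_triangular T ->
  triangle (parameter T c) = T /\ offset (parameter T c) = c.
Proof.
move=> uT; split.
  apply/matrixP => i j; rewrite mxE /entry.
  case: insubP => [u _ Eu|] /=.
    by rewrite mxE enum_rankK Eu /stacked_entry /= liftK.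
  by rewrite /bump /= add1n ltnS -ltnNge => /uT.
apply/rowP => j; rewrite mxE /entry.
case: insubP => [u _ Eu|] //=.
by rewrite mxE enum_rankK Eu /stacked_entry /= unlift_none.
Qed.

Definition ellipsoid_point (x : 'rV[R]_d) p : 'rV[R]_d := x *m triangle p + offset p.

Lemma ellipsoid_point_linear x : linear (ellipsoid_point x).
Proof.
move=> a p q; rewrite /ellipsoid_point.
have -> : triangle (a *: p + q) = a *: triangle p + triangle q.
  by apply/matrixP => i j; rewrite !mxE entry_linear.
have -> : offset (a *: p + q) = a *: offset p + offset q.
  by apply/rowP => j; rewrite !mxE entry_linear.
by rewrite mulmxDr -scalemxAr scalerDr addrACA.
Qed.

HB.instance Definition _ x :=
  GRing.isLinear.Build R 'rV[R]_N 'rV[R]_d _ (ellipsoid_point x) (ellipsoid_point_linear x).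

Definition inscribed A : set 'rV[R]_N :=
  \bigcap_(x in @euclidean_unit_ball R d) (ellipsoid_point x @^-1` A).

Lemma closed_inscribed A : closed A -> closed (inscribed A).
Proof.
move=> cA; apply: closed_bigI => x _.
exact: ((continuous_closedP (ellipsoid_point x)).1
  (@linear_continuous_rV _ _ _ (ellipsoid_point x))).
Qed.

Lemma convex_inscribed A : convex_set A -> convex_set (inscribed A).
Proof.
move=> /convex_setP cA; apply/convex_setP => p q s t s0 t0 st Ap Aq x Bx.
by rewrite /= linearD !linearZ; apply: cA => //; [exact: Ap|exact: Aq].
Qed.

(** The product is the volume of the ellipsoid measured in units of the volume of
the ball. *)
Definition large (v : R) : set 'rV[R]_N :=
  [set p | (forall i, 0 <= triangle p i i) /\ v <= \prod_i triangle p i i].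

Lemma closed_large v : closed (large v).
Proof.
have ct i : continuous (fun p => triangle p i i).
  by rewrite (_ : (fun p => _) = fun p => entry p (lift ord0 i) i);
    [exact: entry_continuous|apply/funext => p; rewrite mxE].
rewrite (_ : large v = \bigcap_i ((fun p => triangle p i i) @^-1` [set x | 0 <= x]) `&`
    (fun p => \prod_i triangle p i i) @^-1` [set x | v <= x]); last first.
  by apply/seteqP; split => p [p0 vp]; split => // i; [move=> _|]; exact: p0.
apply: closedI.
  apply: closed_bigI => i _; apply: ((continuous_closedP _).1 (ct i)); exact: closed_ge.
apply: ((continuous_closedP (fun p => \prod_i triangle p i i)).1); last exact: closed_ge.
move=> p; apply: (cvg_big _ (nbhs_filter p)) => [|i _]; last exact: ct.
exact: mul_continuous.
Qed.

End EllipsoidCoordinates.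

Section UnitEllipsoids.
Variables (R : realType) (d : nat).
Local Notation N := #|{: coordinate d}|.
Implicit Types (p q : 'rV[R]_N) (A : set 'rV[R]_d).

Lemma convex_large v : 0 < v -> convex_set (@large R d v).
Proof.
move=> v0; apply/convex_setP => p q s t s0 t0 st [p0 vp] [q0 vq].
have E i : triangle (s *: p + t *: q) i i = s * triangle p i i + t * triangle q i i.
  rewrite !mxE entry_linear /= -[X in _ + X]/(entry (t *: q) _ _) -[t *: q]addr0 entry_linear.
  by rewrite (_ : entry 0 _ _ = 0) ?addr0 // /entry; case: insubP => //= u; rewrite mxE.
split=> [i|]; first by rewrite E addr_ge0 // mulr_ge0.
by under eq_bigr do rewrite E; apply: prod_conv_ge.
Qed.

Definition center_only p : 'rV[R]_N := parameter 0 (offset p).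

Lemma inscribed_center_only A p : inscribed A p -> inscribed A (center_only p).
Proof.
move=> Ap x _; rewrite /= /ellipsoid_point.
have [|-> ->] := @parameterK R d 0 (offset p); first by move=> i j; rewrite mxE.
have : ellipsoid_point 0 p = x *m 0 + offset p by rewrite /ellipsoid_point mul0mx mulmx0.
move=> <-; apply: Ap; apply/euclidean_unit_ballE.
by rewrite (_ : sqnorm 0 = 0) //; apply/eqP; rewrite sqnorm_eq0.
Qed.

(** Positivity of the product of the diagonal forces a nonzero entry of T, which
[center_only] erases; this is where the dimension has to be positive. *)
Lemma sqnorm_center_only v p : (0 < d)%N -> 0 < v -> large v p ->
  sqnorm (center_only p) < sqnorm p.
Proof.
move=> d0 v0 [p0 vp].
have le k : center_only p 0 k ^+ 2 <= p 0 k ^+ 2.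
  have [u ->] : exists u : coordinate d, k = enum_rank u.
    by exists (enum_val k); rewrite enum_valK.
  rewrite mxE enum_rankK; case: u => -[j i] ji; rewrite /stacked_entry /=.
  case: (unliftP ord0 i) => [h _|E] /=; first by rewrite mxE expr0n sqr_ge0.
  by rewrite mxE /entry; case: insubP => [u _ Eu|/negP//] /=;
    rewrite (_ : u = exist _ (j, i) ji) //; apply: val_inj; rewrite /= Eu E.
pose i := Ordinal d0.
have Ti : triangle p i i != 0.
  apply: contraTneq vp => Ti; rewrite (bigD1 i) //= Ti mul0r -ltNge //.
move: Ti; rewrite mxE /entry; case: insubP => [u _ Eu|]; last by rewrite /= eqxx.
move=> /= pu; rewrite /sqnorm (bigD1 (enum_rank u)) //= [ltRHS](bigD1 (enum_rank u)) //=.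
apply: ltr_leD; last by apply: ler_sum => k _; exact: le.
rewrite mxE enum_rankK Eu /stacked_entry /= liftK /= mxE expr0n /=.
by rewrite lt_neqAle sqr_ge0 andbT eq_sym sqrf_eq0.
Qed.

(** The orthogonal factor of the QR decomposition preserves the unit ball. *)
Lemma ellipsoid_triangular (E : set 'rV[R]_d) : ellipsoid E ->
  exists (T : 'M[R]_d) (c : 'rV[R]_d), [/\ upper_triangular T, forall i, 0 < T i i &
    E = [set x *m T + c | x in @euclidean_unit_ball R d]].
Proof.
move=> [M Mu [c ->]]; have [Q [T [QQ MQT uT T0]]] := QR_decomposition M.
exists T, c; split => // [i|].
  rewrite lt_neqAle T0 andbT eq_sym; apply: contraTneq Mu => Ti.
  by rewrite MQT unitmxE det_mulmx (upper_triangular_det uT) (bigD1 i) //= Ti mul0r mulr0 unitr0.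
have normQ (x : 'rV[R]_d) (O : 'M[R]_d) : O *m O^T = 1%:M -> sqnorm (x *m O) = sqnorm x.
  move=> OO; have : (sqnorm (x *m O))%:M = (sqnorm x)%:M :> 'M[R]_(1, 1).
    by rewrite !sqnormE trmx_mul mulmxA -(mulmxA x) OO mulmx1.
  by move/matrixP/(_ 0 0); rewrite !mxE eqxx !mulr1n.
apply/seteqP; split => y [x /euclidean_unit_ballE xB <-].
  exists (x *m Q); last by rewrite MQT mulmxA.
  by apply/euclidean_unit_ballE; rewrite normQ.
exists (x *m Q^T); last by rewrite MQT mulmxA -(mulmxA x) (mulmx1C QQ) mulmx1.
by apply/euclidean_unit_ballE; rewrite normQ // trmxK; exact: mulmx1C.
Qed.

(** The existence of one ellipsoid of volume one already shows that the volume of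
the ball is positive and finite. *)
Lemma volume_ball_of_unit_ellipsoid A : contains_unit_ellipsoid A ->
  exists2 v : R, 0 < v & volume (@euclidean_unit_ball R d) = (v^-1)%:E.
Proof.
move=> [E [/ellipsoid_triangular[T [c [uT T0 ->]]] + _]].
rewrite volume_triangular_image //.
set w : R := \prod_i T i i; have w0 : 0 < w by exact: prodr_gt0.
case: (volume _) => [r| |].
- rewrite -EFinM => -[wr]; exists w; first exact: w0.
  congr _%:E.
  by rewrite -[RHS]mulr1 -wr mulKf // lt0r_neq0.
- by rewrite gt0_muley // lte_fin.
- by rewrite gt0_muleNy // lte_fin.
Qed.

(** From a large inscribed ellipsoid one gets volume exactly v times that of the
ball by multiplying the first row of T by v / w, where w is the product of its
diagonal; as v / w <= 1, the ellipsoid only shrinks. *)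
Lemma contains_unit_ellipsoidP v A : (0 < d)%N -> 0 < v ->
  volume (@euclidean_unit_ball R d) = (v^-1)%:E ->
  contains_unit_ellipsoid A <-> (inscribed A `&` large v) !=set0.
Proof.
move=> d0 v0 volB; split.
  move=> [E [/ellipsoid_triangular[T [c [uT T0 ->]]] + EA]].
  rewrite volume_triangular_image // volB -EFinM => -[wv].
  exists (parameter T c); have [Tp cp] := parameterK c uT; split.
    by move=> x Bx; rewrite /= /ellipsoid_point Tp cp; apply: EA; exists x.
  rewrite /large /= Tp; split=> [i|]; first exact: ltW.
  by rewrite -[leRHS](mulfVK (lt0r_neq0 v0)) wv mul1r.
move=> [p [Ap [p0 vp]]].
set w := \prod_i _ in vp; have w0 : 0 < w by exact: lt_le_trans vp.
have T0 i : 0 < triangle p i i.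
  rewrite lt_neqAle p0 andbT eq_sym; apply: contraTneq w0 => Ti.
  by rewrite /w (bigD1 i) //= Ti mul0r ltxx.
pose i0 := Ordinal d0.
pose s : 'rV[R]_d := \row_i (if i == i0 then v / w else 1).
have s0 i : 0 < s 0 i <= 1.
  rewrite mxE; case: ifP => _; last by rewrite ltr01 lexx.
  by rewrite divr_gt0 // ler_pdivrMr // mul1r.
pose T := diag_mx s *m triangle p.
have TE i j : T i j = s 0 i * triangle p i j by rewrite /T mul_diag_mx mxE.
have uT : upper_triangular T by move=> i j ij; rewrite TE triangle_upper ?mulr0.
have TT0 i : 0 < T i i by rewrite TE mulr_gt0 //; case/andP: (s0 i).
exists [set x *m T + offset p | x in @euclidean_unit_ball R d]; split.
- exists T; first by rewrite unitmxE upper_triangular_det // unitfE lt0r_neq0 // prodr_gt0.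
  by exists (offset p).
- rewrite volume_triangular_image // volB -EFinM; congr _%:E.
  under eq_bigr do rewrite TE; rewrite big_split /= -/w.
  rewrite (bigD1 i0) //= big1 => [|i /negbTE ii0]; last by rewrite mxE ii0.
  by rewrite mxE eqxx mulr1 mulfVK ?divff // lt0r_neq0.
- move=> y [x /euclidean_unit_ballE Bx <-]; rewrite /T mulmxA.
  apply: (Ap (x *m diag_mx s)); apply/euclidean_unit_ballE; apply: le_trans Bx.
  apply: ler_sum => i _; rewrite mul_mx_diag mxE exprMn ler_piMr ?sqr_ge0 //.
  by have /andP[si0 si1] := s0 i; rewrite exprn_ile1 // ltW.
Qed.

End UnitEllipsoids.

(** * Fractional Helly theorem for ellipsoids of volume one *)

Unset Implicit Arguments.

Theorem proposition1p5 (R : realType) (d : nat) (alpha : R) (I : finType)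
    (C : I -> set 'rV[R]_d) :
  (0 < d)%N -> 0 < alpha < 1 -> (forall i, convex_body (C i)) ->
  (d * (d + 3) %/ 2 <= #|I|)%N ->
  alpha * 'C(#|I|, d * (d + 3) %/ 2)%:R <=
    #|[pred J : {set I} | (#|J| == d * (d + 3) %/ 2)%N
        && `[< contains_unit_ellipsoid (\bigcap_(i in [set` J]) C i) >]]|%:R ->
  exists J : {set I},
    2 * alpha / (d * (d + 3))%N%:R * #|I|%:R <= #|J|%:R
    /\ contains_unit_ellipsoid (\bigcap_(i in [set` J]) C i).
Proof.
move=> d0 /andP[a0 a1] bodyC.
have NE := double_card_coordinate d.
rewrite -NE mulKn //; set N := #|{: coordinate d}| in NE *.
have N0 : (0 < N)%N by rewrite -(@ltn_pmul2l 2) // muln0 NE muln_gt0 d0 addn3.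
pose good : {set {set I}} := [set J : {set I} | (#|J| == N)%N
        && `[< contains_unit_ellipsoid (\bigcap_(i in [set` J]) C i) >]]%SET.
rewrite (_ : #|[pred J : {set I} | _]| = #|good|); last first.
  by apply: eq_card => J; rewrite !inE.
move=> NI le_good.
have [L0 L0good] : exists L, L \in good.
  apply/finset.set0Pn; rewrite -card_gt0 -(ltr0n R); apply: lt_le_trans le_good.
  by rewrite mulr_gt0 // ltr0n bin_gt0.
have [v v0 volB] : exists2 v : R, 0 < v & volume (@euclidean_unit_ball R d) = (v^-1)%:E.
  move: L0good; rewrite inE => /andP[_ /asboolP]; exact: volume_ball_of_unit_ellipsoid.
pose K i := inscribed (C i).
have feasibleE (J : {set I}) p :
    (inscribed (\bigcap_(i in [set` J]) C i) `&` large v) p <-> feasible K (large v) J p.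
  split => -[Kp Dp]; split => //; first by move=> i Ji x Bx; exact: (Kp x Bx i Ji).
  by move=> x Bx i Ji; exact: (Kp i Ji x Bx).
have unitP (J : {set I}) : contains_unit_ellipsoid (\bigcap_(i in [set` J]) C i) <->
    feasible K (large v) J !=set0.
  rewrite (contains_unit_ellipsoidP _ d0 v0 volB); split => -[p] /feasibleE ?; by exists p.
have cvxK i : convex_set (K i) by apply: convex_inscribed; case: (bodyC i).
have clK i : closed (K i).
  by apply: closed_inscribed; apply: compact_closed; case: (bodyC i).
have flatK i p : K i p -> K i (@center_only R d p) by exact: inscribed_center_only.
have flatD p : large v p -> sqnorm (@center_only R d p) < sqnorm p.
  exact: sqnorm_center_only.
pose least (J : {set I}) := least_norm (feasible K (large v) J).
pose S (J : {set I}) : {set I} := [set i | `[< K i (least J) >]]%SET.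
have [|||| J [L [Lgood JL cJ le_S]]] :=
    @pigeonhole_determining_subset R I N.-1 alpha good S.
- by rewrite a0 ltW.
- by rewrite prednK.
- move=> L; rewrite inE => /andP[/eqP cL /asboolP/unitP L_feasible].
  rewrite prednK //; split => //.
  have [J [JL cJ leastJ]] := least_norm_determined cvxK (convex_large v0) clK
    (@closed_large R d v) flatK flatD N0 cL L_feasible.
  exists J; split => //; apply/fintype.subsetP => i Li; rewrite inE; apply/asboolP.
  rewrite /least leastJ.
  by have [[Kp _] _] := least_norm_feasible clK (@closed_large R d v) L_feasible; exact: Kp.
- by rewrite prednK.
exists (S J); split.
  rewrite prednK // in le_S.
  have NR : 0 < N%:R :> R by rewrite ltr0n.
  have -> : 2 * alpha / (2 * N)%:R * #|I|%:R = alpha * #|I|%:R / N%:R.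
    by rewrite natrM; field; rewrite gt_eqF.
  by rewrite ler_pdivrMr // [leRHS]mulrC.
apply/unitP; exists (least J).
have Jfeasible : feasible K (large v) J !=set0.
  move: Lgood; rewrite inE => /andP[_ /asboolP/unitP[p [Kp Dp]]].
  by exists p; split => // i Ji; apply: Kp; apply: (fintype.subsetP JL).
have [[_ Dp] _] := least_norm_feasible clK (@closed_large R d v) Jfeasible.
by split => // i; rewrite /= inE => /asboolP.
Qed.
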